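(* Let $\mathcal{D}\subset\mathbb{R}^d$, let $W$ be a Gaussian random field on $\mathcal{D}$ with mean function $\mu_W$, variance function $\sigma_W^2$ and covariance function $q_W$, let $l$ be a Lévy process independent of $W$ with existing first and second moment, $\mu_l(t)=\mathbb{E}(l(t))$ and $\mu_l^{(2)}(t):=\mathbb{E}(l(t)^2)$ for $t\ge0$, and let $F:\mathbb{R}\to\mathbb{R}_+$ be measurable. Let $L(\underline{x})=l(F(W(\underline{x})))$, $\underline{x}\in\mathcal{D}$, be the Gaussian subordinated Lévy field. Then, for $\underline{x}\ne\underline{x}'\in\mathcal{D}$, the covariance function of $L$ is given by $$q_L(\underline{x},\underline{x}')=\int_{\mathbb{R}^2}c_l(F(u),F(v))\,f_{(W(\underline{x}),W(\underline{x}'))}(u,v)\,d(u,v)-\int_{\mathbb{R}}\mu_l(F(u))f_{W(\underline{x})}(u)\,du\int_{\mathbb{R}}\mu_l(F(v))f_{W(\underline{x}')}(v)\,dv,$$ where $$f_{W(\underline{x})}(u):=\frac{\exp\Big(-\frac{(u-\mu_W(\underline{x}))^2}{2\sigma_W^2(\underline{x})}\Big)}{\sqrt{2\pi\sigma_W^2(\underline{x})}},\qquad \Sigma_W(\underline{x},\underline{x}'):=\begin{bmatrix}\sigma_W^2(\underline{x})&q_W(\underline{x},\underline{x}')\\ q_W(\underline{x},\underline{x}')&\sigma_W^2(\underline{x}')\end{bmatrix},$$ $$f_{(W(\underline{x}),W(\underline{x}'))}(u,v):=\frac{\exp\Big(-\frac12\begin{pmatrix}u-\mu_W(\underline{x})\\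 v-\mu_W(\underline{x}')\end{pmatrix}^T\Sigma_W(\underline{x},\underline{x}')^{-1}\begin{pmatrix}u-\mu_W(\underline{x})\\ v-\mu_W(\underline{x}')\end{pmatrix}\Big)}{\sqrt{(2\pi)^2\big(\sigma_W^2(\underline{x})\sigma_W^2(\underline{x}')-q_W^2(\underline{x},\underline{x}')\big)}}$$ for $u,v\in\mathbb{R}$, and $$c_l(s,t):=\mu_l(|s-t|)\,\mu_l(s\wedge t)+\mu_l^{(2)}(s\wedge t),\qquad s,t\ge0,\quad s\wedge t:=\min(s,t).$$ For $\underline{x}=\underline{x}'\in\mathcal{D}$, the pointwise variance is given by $$\sigma_L^2(\underline{x})=q_L(\underline{x},\underline{x})=\int_{\mathbb{R}}\mu_l^{(2)}(F(u))f_{W(\underline{x})}(u)\,du-\Big(\int_{\mathbb{R}}\mu_l(F(u))f_{W(\underline{x})}(u)\,du\Big)^2.$$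
   Context: All random objects live on a complete probability space $(\Omega,\mathcal{F},\mathbb{P})$; $\mathbb{R}_+=[0,\infty)$. A Lévy process $l=(l(t),t\ge0)$ is a real-valued stochastic process with $l(0)=0$ a.s., independent and stationary increments, stochastically continuous, and taken to have càdlàg paths. A Gaussian random field on $\mathcal{D}$ is a family of real random variables indexed by $\mathcal{D}$ with multivariate Gaussian finite-dimensional distributions, assumed jointly measurable on $\Omega\times\mathcal{D}$; $\mu_W(\underline{x})=\mathbb{E}(W(\underline{x}))$, $q_W(\underline{x},\underline{x}')=\mathrm{Cov}(W(\underline{x}),W(\underline{x}'))$, $\sigma_W^2(\underline{x})=q_W(\underline{x},\underline{x})$. The covariance function of $L$ is $q_L(\underline{x},\underline{x}')=\mathrm{Cov}(L(\underline{x}),L(\underline{x}'))$.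
   Formalization: The covariance formula is stated when Σ_W(x,x') is invertible and L(x), L(x'), L(x)L(x') are integrable, the variance formula when σ_W²(x)≠0 and L(x) is integrable; otherwise the densities or moments are undefined, e.g. l(t)=t, F(u)=exp(u²), W(x) standard normal. *)

(* Defs.v *)
From HB Require Import structures.
From mathcomp Require Import all_boot all_order all_algebra.
From mathcomp Require Import all_classical all_reals all_analysis.

Set Implicit Arguments.
Unset Strict Implicit.
Unset Printing Implicit Defensive.

Import Order.TTheory GRing.Theory Num.Theory.
Import numFieldNormedType.Exports.

Local Open Scope classical_set_scope.
Local Open Scope ring_scope.

Section independence.
Context (R : realType) (dT : measure_display) (T : measurableType dT).
Variable P : probability T R.

(* The product rule for subfamilies is the case where some [B i] are [setT]. *)
Definition mutually_independent n (X : 'I_n -> T -> R) : Prop :=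
  forall B : 'I_n -> set R, (forall i, measurable (B i)) ->
    (P (\bigcap_(i in [set: 'I_n]) (X i @^-1` B i)) =
     \prod_(i < n) P (X i @^-1` B i))%E.

Definition sigma_generated (I : Type) (J : set I) (X : I -> T -> R)
    : set (set T) :=
  <<s \bigcup_(i in J) preimage_set_system setT (X i) measurable >>.

Definition independent_processes (I I' : Type) (J : set I) (X : I -> T -> R)
    (J' : set I') (Y : I' -> T -> R) : Prop :=
  forall A B : set T, sigma_generated J X A -> sigma_generated J' Y B ->
    (P (A `&` B) = P A * P B)%E.

End independence.

Section gaussian.
Context (R : realType) (dT : measure_display) (T : measurableType dT).
Variable P : probability T R.

(* [X] has the law of [m + A Z], with [Z] a vector of [n] independent standard
   normal variables on some probability space. [A] may be singular, so
   degenerate Gaussian laws are included; the covariance matrix is [A *m A^T]. *)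
Definition multivariate_gaussian n (X : 'I_n -> T -> R) : Prop :=
  exists (dS : measure_display) (S : measurableType dS) (Q : probability S R)
         (Z : 'I_n -> {RV Q >-> R}) (m : 'I_n -> R) (A : 'M[R]_n),
    [/\ mutually_independent Q (fun i => Z i : S -> R),
        forall i (B : set R), measurable B ->
          distribution Q (Z i) B = normal_prob 0 1 B &
        forall B : set (n.-tuple R), measurable B ->
          P [set w | B [tuple X i w | i < n]] =
          Q [set s | B [tuple m i + \sum_(j < n) A i j * Z j s | i < n]]].

(* Measurability with respect to the trace on [T * D] of the product of the
   sigma-algebra of [T] and of the Borel sigma-algebra; [D] need not be Borel. *)
Definition jointly_measurable d (D : set 'rV[R]_d) (W : 'rV[R]_d -> T -> R)
    : Prop :=
  forall B : set R, measurable B ->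
    exists2 E : set (T * g_sigma_algebraType (@open 'rV[R]_d)), measurable E &
      [set p | D p.2 /\ B (W p.2 p.1)] = E `&` [set p | D p.2].

(* Only the values of [W] on [D] matter. *)
Definition gaussian_random_field d (D : set 'rV[R]_d)
    (W : 'rV[R]_d -> {RV P >-> R}) : Prop :=
  jointly_measurable D (fun x => W x : T -> R) /\
  forall n (x : 'I_n -> 'rV[R]_d), (forall i, D (x i)) ->
    multivariate_gaussian (fun i => W (x i) : T -> R).

End gaussian.

Arguments gaussian_random_field {R dT T} P {d} D W.

Section levy.
Context (R : realType) (dT : measure_display) (T : measurableType dT).
Variable P : probability T R.

Definition cadlag (f : R -> R) : Prop :=
  forall t, 0 <= t ->
    (f s @[s --> t^'+] --> f t) /\ (0 < t -> cvg (f s @[s --> t^'-])).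

(* The time set is [0, +oo[: values at negative times are unconstrained. *)
Record levy_process (l : R -> {RV P >-> R}) : Prop := LevyProcess {
  levy0 : {ae P, forall w, l 0 w = 0} ;
  levy_independent_increments : forall n (t : nat -> R), 0 <= t 0%N ->
    {homo t : i j / (i < j)%N >-> i < j} ->
    mutually_independent P (fun (i : 'I_n) w => l (t i.+1) w - l (t i) w) ;
  levy_stationary_increments : forall t h, 0 <= t -> 0 <= h ->
    forall B : set R, measurable B ->
    P [set w | B (l (t + h) w - l t w)] = P [set w | B (l h w - l 0 w)] ;
  levy_stochastically_continuous : forall t e, 0 <= t -> 0 < e ->
    P [set w | e < `|l s w - l t w|]
      @[s --> within [set s | 0 <= s] (nbhs t)] --> (0 : \bar R)%E ;
  levy_cadlag : forall w, cadlag (fun t => l t w)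
}.

Definition has_two_moments (l : R -> {RV P >-> R}) : Prop :=
  forall t, 0 <= t ->
    P.-integrable setT (EFin \o l t) /\
    P.-integrable setT (EFin \o (fun w => l t w ^+ 2)).

End levy.

Arguments levy_process {R dT T} P l.
Arguments has_two_moments {R dT T} P l.

Section moments.
Context (R : realType) (dT : measure_display) (T : measurableType dT).
Variable P : probability T R.

Definition mean_fun (I : Type) (X : I -> T -> R) (i : I) : R :=
  fine 'E_P[X i]%E.

Definition second_moment_fun (I : Type) (X : I -> T -> R) (i : I) : R :=
  fine 'E_P[(fun w => X i w ^+ 2)%R]%E.

Definition cov_fun (I : Type) (X : I -> T -> R) (i j : I) : R :=
  fine (covariance P (X i) (X j)).

Definition var_fun (I : Type) (X : I -> T -> R) (i : I) : R := cov_fun X i i.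

Definition cov_mx (I : Type) (X : I -> T -> R) (i j : I) : 'M[R]_(1 + 1) :=
  block_mx (var_fun X i)%:M (cov_fun X i j)%:M
           (cov_fun X i j)%:M (var_fun X j)%:M.

Definition gauss_density (I : Type) (X : I -> T -> R) (i : I) (u : R) : R :=
  expR (- ((u - mean_fun X i) ^+ 2 / (2 * var_fun X i))) /
  Num.sqrt (2 * pi * var_fun X i).

Definition gauss_density2 (I : Type) (X : I -> T -> R) (i j : I) (u v : R)
    : R :=
  let z : 'cV[R]_(1 + 1) :=
    col_mx (u - mean_fun X i)%:M (v - mean_fun X j)%:M in
  expR (- (2^-1 * (z^T *m invmx (cov_mx X i j) *m z) 0 0)) /
  Num.sqrt ((2 * pi) ^+ 2 *
            (var_fun X i * var_fun X j - cov_fun X i j ^+ 2)).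

Definition levy_c (l : R -> T -> R) (s t : R) : R :=
  mean_fun l `|s - t| * mean_fun l (Num.min s t)
  + second_moment_fun l (Num.min s t).

Definition subordinated_field (I : Type) (l : R -> T -> R) (F : R -> R)
    (W : I -> T -> R) : I -> T -> R :=
  fun x w => l (F (W x w)) w.

End moments.

(* Main.v *)
(* Conditionally on W, the field L is l evaluated at the frozen times
   F (W x), F (W x').  Right-continuity makes (t, w) |-> l t w jointly
   measurable for the product of the Borel sets with the sigma-algebra generated
   by l; by independence the joint law of (W x, W x') and l is a product, so
   Fubini's theorem turns E[L x L x'] into the integral of E[l s l t] at
   s = F u, t = F v against the law of (W x, W x').  Independence and
   stationarity of the increments give E[l s l t] = c_l s t.  Finally, writing
   (W x, W x') = m + A Z with Z standard normal, the mean is m and the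
   covariance A A^T, and a linear change of variables produces the densities. *)
Require Import Defs.
From HB Require Import structures.
From mathcomp Require Import all_boot all_order all_algebra.
From mathcomp Require Import all_classical all_reals all_analysis.
From mathcomp Require Import measurable_realfun ring lra.

Set Implicit Arguments.
Unset Strict Implicit.
Unset Printing Implicit Defensive.

Import Order.TTheory GRing.Theory Num.Theory.
Import numFieldNormedType.Exports.
Local Open Scope classical_set_scope.
Local Open Scope ring_scope.

(** * Independence and product laws *)

(** No path space is built for [l]. The second factor of the product law is [T] itself with the
    coarser sigma-algebra generated by [l], and the identity of [T] plays the role of the whole
    path. Independence of the processes then becomes independence of two maps, and the evaluation at
    a random time has to be measurable for this coarse copy, because independence says nothing about
    other events.

    The Gaussian hypothesis only gives equality in law with a vector on an auxiliary space, so each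
    Gaussian expectation is first carried there. The changes of variables are proved for nonnegative
    integrands, where Tonelli and scaling need no finiteness. Signed integrands follow because
    multiplication by a nonnegative density commutes with positive and negative parts. Hence
    integrability of the field enters only in Fubini's theorem and in the expansion of the
    covariance, and the variance formula may read [+oo = +oo]. *)

Section pushforward_integral.
Local Open Scope ereal_scope.
Context d1 d2 (T1 : measurableType d1) (T2 : measurableType d2) (R : realType).
Variables (phi : T1 -> T2) (mphi : measurable_fun setT phi).
Variable mu : {measure set T1 -> \bar R}.

(** An extended-real integral is the difference of the integrals of the positive and negative parts,
    so the equality holds even for integrands that are not integrable. *)
Lemma integral_pushforward_measurable (f : T2 -> \bar R) :
  measurable_fun setT f ->
  \int[pushforward mu phi]_y f y = \int[mu]_x f (phi x).
Proof.
move=> mf; rewrite [RHS]integralE [LHS]integralE; congr (_ - _).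
  rewrite (ge0_integral_pushforward mphi mu measurableT)//.
    by rewrite preimage_setT -funepos_comp.
  exact: measurable_funepos.
rewrite (ge0_integral_pushforward mphi mu measurableT)//.
  by rewrite preimage_setT -funeneg_comp.
exact: measurable_funeneg.
Qed.

End pushforward_integral.

Section independent_pair.
Local Open Scope ereal_scope.
Context d d1 d2 (T : measurableType d) (T1 : measurableType d1)
  (T2 : measurableType d2) (R : realType) (P : probability T R).

(** The codomains are arbitrary measurable spaces so that [Y] can be the identity of [T] into a copy
    of [T] with a smaller sigma-algebra. *)
Definition independent_pair (X : T -> T1) (Y : T -> T2) : Prop :=
  forall A B, measurable A -> measurable B ->
    P (X @^-1` A `&` Y @^-1` B) = P (X @^-1` A) * P (Y @^-1` B).

Variables (X : T -> T1) (Y : T -> T2).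
Hypotheses (mX : measurable_fun setT X) (mY : measurable_fun setT Y).
Hypothesis XY : independent_pair X Y.

Let X' : {mfun T >-> T1} := HB.pack X (isMeasurableFun.Build _ _ _ _ X mX).
Let Y' : {mfun T >-> T2} := HB.pack Y (isMeasurableFun.Build _ _ _ _ Y mY).
Let mXY : measurable_fun setT (fun w => (X w, Y w)).
Proof. exact: measurable_fun_pair. Qed.
Let XY' : {mfun T >-> (T1 * T2)%type} :=
  HB.pack (fun w => (X w, Y w)) (isMeasurableFun.Build _ _ _ _ _ mXY).

(** Independence identifies the law of the pair with the product of the marginal laws on rectangles,
    and rectangles determine the product measure. *)
Let integral_joint_law (h : T1 * T2 -> \bar R) :
  measurable_fun setT h ->
  \int[distribution P X' \x distribution P Y']_p h p = \int[P]_w h (X w, Y w).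
Proof.
move=> mh; rewrite -(integral_pushforward_measurable mXY)//.
apply: eq_measure_integral => A mA _.
have XYE B C : measurable B -> measurable C ->
    distribution P XY' (B `*` C) = distribution P X' B * distribution P Y' C.
  exact: XY.
exact: (@product_measure_unique _ _ _ _ _ (distribution P X')
  (distribution P Y') (distribution P XY') XYE A mA).
Qed.

Lemma ge0_integral_independent (h : T1 * T2 -> \bar R) :
  measurable_fun setT h -> (forall p, 0 <= h p) ->
  \int[P]_w h (X w, Y w) = \int[P]_w1 \int[P]_w2 h (X w1, Y w2).
Proof.
move=> mh h0; rewrite -integral_joint_law// fubini_tonelli1//.
rewrite (integral_pushforward_measurable mX); last first.
  exact: (measurable_fun_fubini_tonelli_F).
apply: eq_integral => w _.
rewrite /fubini_F (integral_pushforward_measurable mY)//.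
exact: measurableT_comp.
Qed.

(** This is the source of the measurability in [u] of moments such as the mean of [l] at time [F u].
    Tonelli gives it for the positive and negative parts of [h]. *)
Lemma measurable_fun_integral_section (h : T1 * T2 -> \bar R) :
  measurable_fun setT h -> measurable_fun setT (fun x => \int[P]_w h (x, Y w)).
Proof.
move=> mh; have mG g : measurable_fun setT g -> (forall p : T1 * T2, 0 <= g p) ->
    measurable_fun setT (fun x => \int[P]_w g (x, Y w)).
  move=> mg g0; rewrite [X in measurable_fun _ X](_ : _ =
      fubini_F (distribution P Y') g); last first.
    apply/funext => x; rewrite /fubini_F.
    rewrite (integral_pushforward_measurable mY)//.
    exact: measurableT_comp.
  exact: measurable_fun_fubini_tonelli_F.
rewrite [X in measurable_fun _ X](_ : _ =
   (fun x => \int[P]_w h^\+ (x, Y w)) \- (fun x => \int[P]_w h^\- (x, Y w))).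
  by apply: emeasurable_funB; apply: mG => //;
    [exact: measurable_funepos|exact: measurable_funeneg].
by apply/funext => x; rewrite integralE funepos_comp/= funeneg_comp.
Qed.

Lemma integral_independent (h : T1 * T2 -> \bar R) :
  measurable_fun setT h -> P.-integrable setT (fun w => h (X w, Y w)) ->
  \int[P]_w h (X w, Y w) = \int[P]_w1 \int[P]_w2 h (X w1, Y w2).
Proof.
move=> mh ih; rewrite -integral_joint_law// -integral12_prod_meas1; last first.
  (* Integrability under the product law is the joint-law identity applied to the absolute value of
     [h]. *)
  apply/integrableP; split => //; rewrite integral_joint_law.
    by case/integrableP : ih.
  exact: measurableT_comp.
rewrite (integral_pushforward_measurable mX); last first.
  rewrite [X in measurable_fun _ X](_ : _ =
      (fun x => \int[P]_w h (x, Y w))).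
    exact: measurable_fun_integral_section.
  apply/funext => x; rewrite /fubini_F.
  rewrite (integral_pushforward_measurable mY)//.
  exact: measurableT_comp.
apply: eq_integral => w _.
rewrite /fubini_F (integral_pushforward_measurable mY)//.
exact: measurableT_comp.
Qed.

End independent_pair.
Arguments independent_pair {d d1 d2 T T1 T2 R} P X Y.

Section independent_product.
Local Open Scope ereal_scope.
Context d (T : measurableType d) (R : realType) (P : probability T R).

Variables X Y : T -> R.
Hypotheses (iX : P.-integrable setT (EFin \o X))
  (iY : P.-integrable setT (EFin \o Y)) (XY : independent_pair P X Y).

Let mX : measurable_fun setT X.
Proof. by apply/measurable_EFinP; exact: measurable_int iX. Qed.
Let mY : measurable_fun setT Y.
Proof. by apply/measurable_EFinP; exact: measurable_int iY. Qed.

(** By Tonelli, [E|XY| = E|X| E|Y|], so two finite first moments suffice. *)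
Lemma integrable_independentM : P.-integrable setT (fun w => (X w * Y w)%:E).
Proof.
apply/integrableP; split; first exact/measurable_EFinP/measurable_funM.
rewrite (ge0_integral_independent mX mY XY
  (h := fun p : R * R => `|(p.1 * p.2)%:E|))//; last first.
  by apply: measurableT_comp => //; apply/measurable_EFinP; exact: measurable_funM.
under eq_integral => w _.
  under eq_integral => w' _ do rewrite /= normrM EFinM.
  rewrite ge0_integralZl//; last first.
    by apply/measurable_EFinP/measurableT_comp.
  over.
rewrite ge0_integralZr//.
- by apply: lte_mul_pinfty; rewrite ?integral_ge0 ?ge0_fin_numE ?integral_ge0//;
    [case/integrableP : iX|case/integrableP : iY].
- by apply/measurable_EFinP/measurableT_comp.
- exact: integral_ge0.
Qed.

Lemma integral_independentM :
  \int[P]_w (X w * Y w)%:E = \int[P]_w (X w)%:E * \int[P]_w (Y w)%:E.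
Proof.
rewrite (integral_independent mX mY XY
  (h := fun p : R * R => (p.1 * p.2)%:E))//.
- under eq_integral => w _.
    under eq_integral => w' _ do rewrite /= EFinM.
    rewrite integralZl//; over.
  have iYfin := integrable_fin_num measurableT iY.
  by rewrite -(fineK iYfin) integralZr.
- by apply/measurable_EFinP; exact: measurable_funM.
- exact: integrable_independentM.
Qed.

End independent_product.

Lemma mutually_independent_pair (R : realType) d (T : measurableType d)
    (P : probability T R) n (X : 'I_n -> T -> R) (i j : 'I_n) :
  mutually_independent P X -> i != j -> independent_pair P (X i) (X j).
Proof.
move=> indX ij A B mA mB.
pose C k : set R := if k == i then A else if k == j then B else setT.
have Ci : C i = A by rewrite /C eqxx.
have Cj : C j = B by rewrite /C eq_sym (negbTE ij) eqxx.
have Ck k : k != i -> k != j -> C k = setT.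
  by move=> ki kj; rewrite /C (negbTE ki) (negbTE kj).
have mC k : measurable (C k) by rewrite /C; case: ifP => // _; case: ifP.
have := indX C mC; rewrite (bigD1 i)//= (bigD1 j) 1?eq_sym//= big1 => [|k /andP[ki kj]].
  rewrite Ci Cj mule1 => <-; congr (P _).
  apply/seteqP; split => [w [Aw Bw] k _|w Cw].
    have [->|ki] := eqVneq k i; first by rewrite /= Ci.
    by have [->|kj] := eqVneq k j; [rewrite /= Cj|rewrite /= Ck].
  by split; [have := Cw i I; rewrite /= Ci|have := Cw j I; rewrite /= Cj].
by rewrite Ck// preimage_setT probability_setT.
Qed.

(** * Changes of variables for the Lebesgue measure *)

Section density.
Local Open Scope ereal_scope.
Context d (T : measurableType d) (R : realType).
Variables (m mu : {measure set T -> \bar R}) (f : T -> R).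
Hypotheses (mf : measurable_fun setT f) (f0 : forall x, (0 <= f x)%R).
Hypothesis mE : forall A, measurable A -> m A = \int[mu]_(x in A) (f x)%:E.

Import HBNNSimple.

(** The hypothesis is the case of indicators. Linearity gives simple functions, and monotone
    convergence on both sides gives the rest. *)
Lemma ge0_integral_density (g : T -> \bar R) :
  measurable_fun setT g -> (forall x, 0 <= g x) ->
  \int[m]_x g x = \int[mu]_x (g x * (f x)%:E).
Proof.
move=> mg g0.
pose h := nnsfun_approx measurableT mg.
have hE x : (h n x)%:E @[n --> \oo] --> g x by exact: cvg_nnsfun_approx.
transitivity (limn (fun n => \int[m]_x (h n x)%:E)).
  rewrite -monotone_convergence//.
  - by apply: eq_integral => x _; apply/esym/cvg_lim => //; exact: hE.
  - by move=> n; exact/measurable_EFinP.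
  - by move=> n x _; rewrite lee_fin.
  - by move=> x _ a b ab; rewrite lee_fin; exact/lefP/nd_nnsfun_approx.
transitivity (limn (fun n => \int[mu]_x ((h n x)%:E * (f x)%:E))); last first.
  rewrite -monotone_convergence//.
  - apply: eq_integral => x _; apply/cvg_lim => //.
    by apply: cvgeZr => //; exact: hE.
  - by move=> n; apply: emeasurable_funM; exact/measurable_EFinP.
  - by move=> n x _; rewrite mule_ge0 ?lee_fin.
  - move=> x _ a b ab; rewrite lee_wpmul2r ?lee_fin//.
    exact/lefP/nd_nnsfun_approx.
congr (limn _); apply/funext => n.
have mh r : measurable (h n @^-1` [set r]) by exact: measurable_sfunP.
transitivity (\sum_(r \in range (h n)) (r%:E * m (h n @^-1` [set r]))).
  under eq_integral do rewrite fimfunE -fsumEFin//.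
  rewrite ge0_integral_fsum//.
  - apply: eq_fsbigr => r _; rewrite integralZl_indic_nnsfun//.
    by rewrite integral_indic// setIT.
  - by move=> r; exact/measurable_EFinP/measurable_funM.
  - by move=> r x _; exact: nnfun_muleindic_ge0.
transitivity (\int[mu]_x \sum_(r \in range (h n))
    ((r * \1_(h n @^-1` [set r]) x)%:E * (f x)%:E)).
  rewrite ge0_integral_fsum//.
  - apply: eq_fsbigr => r /[!inE] -[x _ <-].
    under eq_integral do rewrite EFinM -muleA.
    rewrite ge0_integralZl//.
    + congr (_ * _); rewrite mE// integral_mkcond.
      apply: eq_integral => y _; rewrite epatch_indic muleC.
      by rewrite /=.
    + by apply: emeasurable_funM; apply/measurable_EFinP => //.
    + by move=> y _; rewrite mule_ge0 ?lee_fin.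
    + by rewrite lee_fin.
  - move=> r; apply: emeasurable_funM; apply/measurable_EFinP => //.
    exact: measurable_funM.
  - by move=> r x _; rewrite mule_ge0 ?lee_fin//; exact: nnfun_muleindic_ge0.
apply: eq_integral => x _.
rewrite -ge0_mule_fsuml; last by move=> r; exact: nnfun_muleindic_ge0.
by rewrite [in RHS]fimfunE -fsumEFin.
Qed.
End density.

Section affine_substitution.
Local Open Scope ereal_scope.
Context (R : realType).
Local Notation mu := (@lebesgue_measure R).

Lemma measurable_fun_affine (a b : R) :
  measurable_fun [set: R] (fun x => a * x + b)%R.
Proof. by apply: measurable_funD => //; exact: measurable_funM. Qed.

(** The rescaled image measure gives half-open intervals their length, and this characterises the
    Lebesgue measure. *)
Lemma lebesgue_measure_affine (a b : R) (A : set R) : a != 0%R ->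
  measurable A -> mu A = `|a|%:E * mu ((fun x => a * x + b)%R @^-1` A).
Proof.
move=> a0 mA.
have mphi : measurable_fun [set: measurableTypeR R]
    (fun x => a * x + b : measurableTypeR R)%R.
  exact: measurable_fun_affine.
pose m := mscale (NngNum (normr_ge0 a))
  (measure_function_pushforward__canonical__measure_function_Measure mu mphi).
apply: (lebesgue_measure_unique (mu := m)) mA => _ [[x y]] _ <- /=.
rewrite /m /mscale /pushforward /=.
have [a_gt0|a_lt0|a_eq0] := ltgtP 0%R a; last by rewrite -a_eq0 eqxx in a0.
  rewrite [X in _ = _ * lebesgue_measure X](_ : _ =
      `]((x - b) / a)%R, ((y - b) / a)%R]%classic); last first.
    apply/seteqP; split => z /=; rewrite !in_itv/=;
      by rewrite ltr_pdivrMr// ler_pdivlMr// ltrBlDr lerBrDr mulrC.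
  rewrite !lebesgue_measure_itv/= !lte_fin ltr_pM2r ?invr_gt0// ltrD2r.
  case: ifPn; rewrite ?mule0// => _.
  by rewrite !EFinN -!EFinD -EFinM gtr0_norm//; congr EFin; field; rewrite gt_eqF.
(* A negative slope reverses the interval, so the preimage is closed on the left and open on the
   right. *)
rewrite [X in _ = _ * lebesgue_measure X](_ : _ =
    `[((y - b) / a)%R, ((x - b) / a)%R[%classic); last first.
  apply/seteqP; split => z /=; rewrite !in_itv/=;
    by rewrite ler_ndivrMr// ltr_ndivlMr// ltrBlDr lerBrDr mulrC andbC.
rewrite !lebesgue_measure_itv/= !lte_fin ltr_nM2r ?invr_lt0// ltrD2r.
case: ifPn; rewrite ?mule0// => _.
by rewrite !EFinN -!EFinD -EFinM ltr0_norm//; congr EFin; field; rewrite lt_eqF.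
Qed.

Lemma ge0_integral_affine (a b : R) (G : R -> \bar R) : a != 0%R ->
  measurable_fun setT G -> (forall x, 0 <= G x) ->
  \int[mu]_x G x = `|a|%:E * \int[mu]_x G (a * x + b)%R.
Proof.
move=> a0 mG G0.
have mphi : measurable_fun [set: measurableTypeR R]
    (fun x => a * x + b : measurableTypeR R)%R.
  exact: measurable_fun_affine.
rewrite -(integral_pushforward_measurable mphi)//.
rewrite -(ge0_integral_mscale _ measurableT (NngNum (normr_ge0 a)))//.
by apply: eq_measure_integral => A mA _; exact: lebesgue_measure_affine.
Qed.

End affine_substitution.

Section linear_substitution2.
Local Open Scope ereal_scope.
Context (R : realType).
Local Notation mu := (@lebesgue_measure R).

Lemma measurable_fun_affine2 (a b c d p q : R) :
  measurable_fun [set: R * R]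
    (fun z => (a * z.1 + b * z.2 + p, c * z.1 + d * z.2 + q)%R).
Proof.
by apply: measurable_fun_pair; apply: measurable_funD => //;
  apply: measurable_funD => //; exact: measurable_funM.
Qed.

(** Triangular factorisation: for fixed [x], the second variable is scaled by [D / a] and shifted,
    which gives [K]. Then, for fixed [y], the first is replaced by [a * x + b * y + p]. The
    one-dimensional factors multiply to [|D / a| |a| = |D|]. *)
Let ge0_integral_affine2_neq0 (a b c d p q : R) (H : R * R -> \bar R) :
  a != 0%R -> (a * d - b * c != 0)%R ->
  measurable_fun setT H -> (forall z, 0 <= H z) ->
  \int[mu \x mu]_z H z = `|a * d - b * c|%:E *
    \int[mu \x mu]_z H (a * z.1 + b * z.2 + p, c * z.1 + d * z.2 + q)%R.
Proof.
move=> a0 D0 mH H0; set D := (a * d - b * c)%R in D0 *.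
have mHL a' b' c' d' p' q' : measurable_fun [set: R * R]
    (fun z => H (a' * z.1 + b' * z.2 + p', c' * z.1 + d' * z.2 + q')%R).
  by apply: measurableT_comp => //; exact: measurable_fun_affine2.
have Da0 : (D / a != 0)%R by rewrite mulf_neq0 ?invr_eq0.
pose K (z : R * R) := H (z.1, D / a * z.2 + (c / a * (z.1 - p) + q))%R.
have mK : measurable_fun setT K.
  have := mHL 1%R 0%R (c / a)%R (D / a)%R 0%R (- (c / a * p) + q)%R.
  apply: eq_measurable_fun => z _; congr (H (_, _)); ring.
have mK1 x : measurable_fun setT (fun y => K (x, y)) by exact: measurableT_comp.
have mK2 y : measurable_fun setT (fun x => K (x, y)) by exact: measurableT_comp.
rewrite fubini_tonelli1// fubini_tonelli2//; last exact: mHL.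
transitivity (\int[mu]_x (`|D / a|%:E * \int[mu]_y K (x, y))).
  apply: eq_integral => x _; rewrite /fubini_F.
  rewrite (ge0_integral_affine (G := fun y => H (x, y))
    (c / a * (x - p) + q)%R Da0)//.
  exact: (measurable_fun_pair2 x mH).
rewrite (ge0_integralZl mu measurableT); last 3 first.
- have mF := measurable_fun_fubini_tonelli_F (m2 := mu) K mK (fun z => H0 _).
  exact mF.
- by move=> x _; apply: integral_ge0 => y _; exact: H0.
- by [].
have swapK := fubini_tonelli (m1 := mu) (m2 := mu) K mK (fun z => H0 _).
transitivity (`|D / a|%:E * \int[mu]_y \int[mu]_x K (x, y)).
  by congr *%E; exact swapK.
transitivity (`|D / a|%:E * \int[mu]_y (`|a|%:E *
    \int[mu]_x H (a * x + b * y + p, c * x + d * y + q)%R)).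
  congr *%E; apply: eq_integral => y _.
  have := ge0_integral_affine (b * y + p)%R a0 (mK2 y) (fun x => H0 _).
  move=> ->; congr *%E.
  apply: eq_integral => x _; rewrite /K/=; congr (H (_, _)).
    by rewrite addrA.
  by rewrite /D; field.
rewrite (ge0_integralZl mu measurableT); last 3 first.
- have mG := measurable_fun_fubini_tonelli_G (m1 := mu) _ (mHL a b c d p q)
    (fun z => H0 _).
  exact mG.
- by move=> x _; apply: integral_ge0 => y _; exact: H0.
- by [].
by rewrite muleA -EFinM -normrM divfK.
Qed.

Lemma ge0_integral_affine2 (a b c d p q : R) (H : R * R -> \bar R) :
  (a * d - b * c != 0)%R ->
  measurable_fun setT H -> (forall z, 0 <= H z) ->
  \int[mu \x mu]_z H z = `|a * d - b * c|%:E *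
    \int[mu \x mu]_z H (a * z.1 + b * z.2 + p, c * z.1 + d * z.2 + q)%R.
Proof.
have [->|a0] := eqVneq a 0%R; last exact: ge0_integral_affine2_neq0.
rewrite mul0r sub0r normrN oppr_eq0 => bc0 mH H0.
have b0 : b != 0%R by apply: contraNneq bc0 => ->; rewrite mul0r.
(* For [a = 0] the columns of the matrix are exchanged, which makes [b] the pivot. Tonelli in both
   orders undoes the exchange of the variables. *)
rewrite (ge0_integral_affine2_neq0 (b := 0%R) (d := c) (c := d) p q b0)//; last first.
  by rewrite mul0r subr0.
have mHL a' b' c' d' p' q' : measurable_fun [set: R * R]
    (fun z => H (a' * z.1 + b' * z.2 + p', c' * z.1 + d' * z.2 + q')%R).
  by apply: measurableT_comp => //; exact: measurable_fun_affine2.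
rewrite mul0r subr0; congr *%E.
rewrite (fubini_tonelli1 (m1 := mu) (m2 := mu) _ (mHL b 0 d c p q)%R
  (fun z => H0 _)).
rewrite (fubini_tonelli2 (m1 := mu) (m2 := mu) _ (mHL 0 b c d p q)%R
  (fun z => H0 _)).
apply: eq_integral => x _; apply: eq_integral => y _ /=.
by rewrite !mul0r addr0 add0r [(d * x + _)%R]addrC.
Qed.

End linear_substitution2.

(** * Gaussian vectors *)

Section standard_normal_moments.
Context (R : realType).
Implicit Types x : R.
Local Notation mu := (@lebesgue_measure R).
Local Notation phi := (@normal_pdf R 0 1).

Lemma std_normal_pdfE x : phi x = normal_peak 1 * expR (- (x ^+ 2 / 2)).
Proof.
rewrite normal_pdfE ?oner_eq0// /normal_fun subr0 expr1n.
by congr (_ * expR _); rewrite mulNr.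
Qed.

Lemma std_normal_pdfN x : phi (- x) = phi x.
Proof. by rewrite !std_normal_pdfE sqrrN. Qed.

Let is_derive_phi x : is_derive x 1 phi (- (x * phi x)).
Proof.
rewrite (_ : phi = fun y : R => normal_peak 1 * expR (- (y ^+ 2 / 2))).
  apply: is_derive_eq.
  rewrite !scaler0 !add0r; rewrite /GRing.scale/=; by field.
by apply/funext => y; exact: std_normal_pdfE.
Qed.

Let is_derive_xphi x :
  is_derive x 1 (fun y => y * phi y) (phi x - x ^+ 2 * phi x).
Proof.
have D := is_derive_phi x.
apply: (is_derive_eq (is_deriveM (is_derive_id x 1) D)).
by rewrite /GRing.scale/=; ring.
Qed.

Let cphi : continuous phi.
Proof. by apply: continuous_normal_pdf; exact: oner_neq0. Qed.

Let cx2phi : continuous (fun x => x ^+ 2 * phi x).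
Proof. by move=> x; apply: cvgM; [exact: exprn_continuous|exact: cphi]. Qed.

Let cvg_xphi : x * phi x @[x --> +oo%R] --> (0 : R).
Proof.
(* The majorant comes from [expR y >= y] at [y = x ^+ 2 / 2]. *)
apply: (@squeeze_cvgr _ _ _ _ (cst 0) (fun x => 2 * normal_peak 1 * x^-1)).
- near=> x.
  have x0 : 0 < x by near: x; exact: nbhs_pinfty_gt.
  have h0 : 0 <= x * phi x by rewrite mulr_ge0 ?normal_pdf_ge0// ltW.
  rewrite h0/= std_normal_pdfE.
  have y0 : 0 < x ^+ 2 / 2 by rewrite divr_gt0// exprn_gt0.
  have -> : 2 * normal_peak 1 * x^-1 = x * (normal_peak 1 * (x ^+ 2 / 2)^-1).
    by field; rewrite gt_eqF.
  rewrite ler_pM2l// ler_wpM2l ?normal_peak_ge0// expRN.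
  rewrite lef_pV2 ?posrE ?expR_gt0//.
  by apply: le_trans (expR_ge1Dx _); rewrite lerDr.
- exact: cvg_cst.
- rewrite -(mulr0 (2 * normal_peak 1)); apply: cvgMr.
  by apply/gtr0_cvgV0 => //; exact: nbhs_pinfty_gt.
Unshelve. all: by end_near. Qed.

Local Open Scope ereal_scope.

(* [phi x - x ^+ 2 * phi x] is the derivative of [x * phi x]; it has constant
   sign on each side of [1], and the boundary terms at [1] cancel. *)
Let integral_phi01 : \int[mu]_(x in `[0%R, 1%R]) (phi x)%:E =
  (phi 1)%:E + \int[mu]_(x in `[0%R, 1%R]) (x ^+ 2 * phi x)%:E.
Proof.
have D01 := @is_derive_xphi.
have := @continuous_FTC2 R (fun x => phi x - x ^+ 2 * phi x)%R
  (fun x => x * phi x)%R 0%R 1%R ltr01.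
rewrite mul0r mul1r sube0 => <-; last first.
- by move=> x _; rewrite derive1E derive_val.
- split=> [x _||].
  + by [].
  + by apply: cvg_at_right_filter; apply: cvgM; [exact: cvg_id|exact: cphi].
  + by apply: cvg_at_left_filter; apply: cvgM; [exact: cvg_id|exact: cphi].
- apply: continuous_subspaceT => x.
  by apply: cvgB; [exact: cphi|exact: cx2phi].
rewrite -ge0_integralD//.
- by apply: eq_integral => x _; rewrite -EFinD subrK.
- move=> x; rewrite /= in_itv/= => /andP[x0 x1].
  rewrite lee_fin subr_ge0 ler_piMl ?normal_pdf_ge0//.
  by rewrite expr_le1.
- apply/measurable_EFinP/measurable_funTS.
  apply: continuous_measurable_fun => x.
  by apply: cvgB; [exact: cphi|exact: cx2phi].
- by move=> x _; rewrite lee_fin mulr_ge0 ?normal_pdf_ge0 ?sqr_ge0.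
- apply/measurable_EFinP/measurable_funTS; apply: continuous_measurable_fun.
  exact: cx2phi.
Qed.

Let integral_phi1y : \int[mu]_(x in `[1%R, +oo[) (x ^+ 2 * phi x)%:E =
  (phi 1)%:E + \int[mu]_(x in `[1%R, +oo[) (phi x)%:E.
Proof.
have D1y := @is_derive_xphi.
have := @ge0_continuous_FTC2y R (fun x => x ^+ 2 * phi x - phi x)%R
  (fun x => - (x * phi x))%R 1%R 0%R.
rewrite mul1r EFinN oppeK add0e => <-; last first.
- move=> x _; rewrite derive1E deriveN//.
  by rewrite derive_val opprB.
- rewrite -(mul1r (phi 1)); apply: cvg_at_right_filter; apply: cvgN.
  by apply: cvgM; [exact: cvg_id|exact: cphi].
- by move=> x _; exact: derivableN.
- have := cvgN cvg_xphi; rewrite oppr0; exact.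
- apply: continuous_subspaceT => x.
  by apply: cvgB; [exact: cx2phi|exact: cphi].
- move=> x x1; rewrite subr_ge0 ler_peMl ?normal_pdf_ge0//.
  by rewrite exprn_ege1.
rewrite -ge0_integralD//.
- by apply: eq_integral => x _; rewrite -EFinD subrK.
- move=> x; rewrite /= in_itv/= andbT => x1.
  by rewrite lee_fin subr_ge0 ler_peMl ?normal_pdf_ge0// exprn_ege1.
- apply/measurable_EFinP/measurable_funTS.
  apply: continuous_measurable_fun => x.
  by apply: cvgB; [exact: cx2phi|exact: cphi].
- by move=> x _; rewrite lee_fin normal_pdf_ge0.
- apply/measurable_EFinP/measurable_funTS; apply: continuous_measurable_fun.
  exact: cphi.
Qed.

(** The integral is compared with the total mass of [phi]. Both integrands are even, so half-lines
    suffice. The two have the same integral over the half-line, because [phi 1] is gained on one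
    side of [1] and lost on the other. Only nonnegative terms are added, so finiteness is not
    presupposed. *)
Lemma integral_sqr_std_normal_pdf :
  \int[mu]_x (x ^+ 2 * phi x)%:E = 1.
Proof.
have phi0 x : (0 <= phi x)%R by exact: normal_pdf_ge0.
have x2phi0 x : (0 <= x ^+ 2 * phi x)%R by rewrite mulr_ge0 ?sqr_ge0.
have phiN : phi =1 phi \o -%R by move=> x; rewrite /= std_normal_pdfN.
have x2phiN : (fun x => x ^+ 2 * phi x)%R =1 (fun x => x ^+ 2 * phi x)%R \o -%R.
  by move=> x; rewrite /= std_normal_pdfN sqrrN.
rewrite -(@integral_normal_pdf R 0 1) (ge0_symfun_integralT phi0 cphi phiN).
rewrite (ge0_symfun_integralT x2phi0 cx2phi x2phiN).
congr *%E.
have splitI (f : R -> R) : continuous f -> (forall x, 0 <= f x)%R ->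
    \int[mu]_(x in [set x | (0 <= x)%R]) (f x)%:E =
    \int[mu]_(x in `[0%R, 1%R]) (f x)%:E + \int[mu]_(x in `[1%R, +oo[) (f x)%:E.
  move=> cf f0; have mf A : measurable_fun A (EFin \o f).
    apply/measurable_EFinP/measurable_funTS; apply: continuous_measurable_fun.
    exact: cf.
  rewrite -(@integral_itv_obnd_cbnd _ 1%R (BInfty _ false))//.
  rewrite -ge0_integral_setU//=.
  - congr integral; rewrite -itv_bndbnd_setU ?bnd_simp// -set_itvcy//.
  - exact: mf.
  - by move=> x _; rewrite lee_fin.
  - by apply: lt_disjoint => x y; rewrite /= !in_itv/= andbT => /andP[_ x1] y1;
      exact: le_lt_trans y1.
rewrite (splitI _ cphi phi0) (splitI _ cx2phi x2phi0).
by rewrite integral_phi01 integral_phi1y addeCA addeA.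
Qed.

End standard_normal_moments.

Section standard_normal_variable.
Local Open Scope ereal_scope.
Context (R : realType) d (S : measurableType d) (Q : probability S R).
Variables (Z : S -> R) (mZ : measurable_fun setT Z).
Hypothesis lawZ : forall B : set R, measurable B ->
  Q (Z @^-1` B) = normal_prob 0 1 B.
Local Notation mu := (@lebesgue_measure R).
Local Notation phi := (@normal_pdf R 0 1).

Let mZ' : measurable_fun setT (Z : S -> measurableTypeR R).
Proof. exact: mZ. Qed.
Let Z' : {mfun S >-> measurableTypeR R} :=
  HB.pack (Z : S -> measurableTypeR R) (isMeasurableFun.Build _ _ _ _ _ mZ').

Lemma ge0_integral_std_normal (G : R -> \bar R) :
  measurable_fun setT G -> (forall x, 0 <= G x) ->
  \int[Q]_w G (Z w) = \int[mu]_x (G x * (phi x)%:E).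
Proof.
move=> mG G0; rewrite -(integral_pushforward_measurable mZ')//.
exact: (@ge0_integral_density _ (measurableTypeR R) R (distribution Q Z') mu
  phi (measurable_normal_pdf 0 1) (normal_pdf_ge0 0 1) lawZ).
Qed.

Lemma integral_sqr_std_normal : \int[Q]_w (Z w ^+ 2)%:E = 1.
Proof.
rewrite (ge0_integral_std_normal (G := fun x => (x ^+ 2)%:E))//.
- by under eq_integral do rewrite -EFinM; exact: integral_sqr_std_normal_pdf.
- by apply/measurable_EFinP; exact: exprn_measurable.
- by move=> x; rewrite lee_fin sqr_ge0.
Qed.

Lemma integrable_sqr_std_normal : Q.-integrable setT (fun w => (Z w ^+ 2)%:E).
Proof.
apply/integrableP; split; first by apply/measurable_EFinP; exact: measurable_funX.
under eq_integral do rewrite gee0_abs ?lee_fin ?sqr_ge0//.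
by rewrite integral_sqr_std_normal ltry.
Qed.

Lemma integrable_std_normal : Q.-integrable setT (fun w => (Z w)%:E).
Proof.
have i1 : Q.-integrable setT (fun w => (1 + Z w ^+ 2)%:E).
  under eq_fun do rewrite EFinD.
  apply: integrableD => //; last exact: integrable_sqr_std_normal.
  by apply: finite_measure_integrable_cst.
apply: le_integrable i1 => //; first exact/measurable_EFinP.
move=> w _; rewrite lee_fin /= [leRHS]ger0_norm ?addr_ge0 ?sqr_ge0//.
rewrite -real_normK ?num_real//.
have := sqr_ge0 (`|Z w| - 2^-1)%R; nra.
Qed.

Lemma ge0_integral_std_normalN (G : R -> \bar R) :
  measurable_fun setT G -> (forall x, 0 <= G x) ->
  \int[Q]_w G (- Z w)%R = \int[Q]_w G (Z w).
Proof.
move=> mG G0.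
have mphi : measurable_fun setT (EFin \o phi).
  by apply/measurable_EFinP; exact: measurable_normal_pdf.
have mGN : measurable_fun setT (fun x : R => G (- x)%R) by exact: measurableT_comp.
rewrite (ge0_integral_std_normal mGN)// (ge0_integral_std_normal mG)//.
have N10 : (-1 != 0 :> R)%R by rewrite oppr_eq0 oner_eq0.
rewrite (ge0_integral_affine (G := fun x => G x * (phi x)%:E) 0%R N10).
- rewrite normrN normr1 mul1e; apply: eq_integral => x _.
  by rewrite addr0 mulN1r std_normal_pdfN.
- exact: emeasurable_funM.
- by move=> x; rewrite mule_ge0// lee_fin normal_pdf_ge0.
Qed.

(** By symmetry of the law, the positive parts of [Z] and of [- Z] have the same finite expectation,
    and [Z] is their difference. *)
Lemma integral_std_normal : \int[Q]_w (Z w)%:E = 0.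
Proof.
have iZ := integrable_std_normal.
have mmax : measurable_fun setT (fun x : R => (Num.max x 0)%:E).
  by apply/measurable_EFinP; exact: measurable_maxr.
have maxE (f : S -> R) : measurable_fun setT f -> (forall w, `|f w| = `|Z w|)%R ->
    Q.-integrable setT (fun w => (Num.max (f w) 0)%:E).
  move=> mf fZ; apply: le_integrable iZ => //.
    by apply/measurable_EFinP; exact: measurable_maxr.
  move=> w _; rewrite lee_fin -fZ ger0_norm ?le_max ?lexx ?orbT//.
  by rewrite ge_max ler_norm normr_ge0.
transitivity (\int[Q]_w ((Num.max (Z w) 0)%:E - (Num.max (- Z w)%R 0)%:E)).
  apply: eq_integral => w _; rewrite -EFinB; congr EFin.
  by case: (leP (Z w) 0%R) => Z0; case: leP => NZ0; lra.
rewrite integralB//; last 2 first.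
- exact: maxE.
- by apply: maxE => [|w]; [exact: measurableT_comp|rewrite normrN].
rewrite (ge0_integral_std_normalN mmax); last first.
  by move=> x; rewrite lee_fin le_max lexx orbT.
by rewrite subee// integrable_fin_num//; exact: maxE.
Qed.

End standard_normal_variable.

Section gaussian_vector.
Local Open Scope ereal_scope.
Context (R : realType) d (T : measurableType d) (P : probability T R).
Context n (X : 'I_n -> T -> R) (mX : forall i, measurable_fun setT (X i)).
Context dS (S : measurableType dS) (Q : probability S R).
Variables (Z : 'I_n -> {RV Q >-> R}) (m : 'I_n -> R) (A : 'M[R]_n).
Hypothesis indZ : mutually_independent Q (fun i => Z i : S -> R).
Hypothesis lawZ : forall i (B : set R), measurable B ->
  distribution Q (Z i) B = normal_prob 0 1 B.
Let Y i s := (m i + \sum_(j < n) A i j * Z j s)%R.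
Hypothesis lawX : forall B : set (n.-tuple R), measurable B ->
  P [set w | B [tuple X i w | i < n]] = Q [set s | B [tuple Y i s | i < n]].

Let mY i : measurable_fun setT (Y i).
Proof.
apply: measurable_funD => //; apply: measurable_sum => j.
exact: measurable_funM.
Qed.

(** Both sides depend only on the law of the tuple. This is the passage from [P] to the auxiliary
    space of [Z]. *)
Lemma integral_gaussian_vector (g : n.-tuple R -> \bar R) :
  measurable_fun setT g ->
  \int[P]_w g [tuple X i w | i < n] = \int[Q]_s g [tuple Y i s | i < n].
Proof.
move=> mg.
have mtuple d' (U : measurableType d') (V : 'I_n -> U -> R) :
    (forall i, measurable_fun setT (V i)) ->
    measurable_fun setT (fun w => [tuple V i w | i < n]).
  move=> mV; apply/measurable_fun_tnthP => i.
  by apply: eq_measurable_fun (mV i) => w _; rewrite /= tnth_mktuple.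
rewrite -(integral_pushforward_measurable (mtuple _ _ _ mX))//.
rewrite -(integral_pushforward_measurable (mtuple _ _ _ mY))//.
apply: eq_measure_integral; first exact: mtuple.
  exact: mtuple.
by move=> ? ? B mB _; exact: lawX.
Qed.

Let lawZ' i (B : set R) : measurable B -> Q (Z i @^-1` B) = normal_prob 0 1 B.
Proof. exact: lawZ. Qed.

Lemma integrable_std_normalM j k : Q.-integrable setT (fun s => (Z j s * Z k s)%:E).
Proof.
have [->|jk] := eqVneq j k.
  by under eq_fun do rewrite -expr2; exact: integrable_sqr_std_normal (lawZ' k).
apply: integrable_independentM; [exact: integrable_std_normal (lawZ' _)..|].
exact: (mutually_independent_pair indZ jk).
Qed.

Lemma integral_std_normalM j k :
  \int[Q]_s (Z j s * Z k s)%:E = (j == k)%:R%:E.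
Proof.
have [->|jk] := eqVneq j k.
  under eq_integral do rewrite -expr2.
  exact: integral_sqr_std_normal (lawZ' k).
rewrite integral_independentM; [|exact: integrable_std_normal (lawZ' _)..|].
  by rewrite !(integral_std_normal _ (lawZ' _))// mule0.
exact: (mutually_independent_pair indZ jk).
Qed.

Lemma integral_gaussian_coord i : \int[P]_w (X i w)%:E = (m i)%:E.
Proof.
transitivity (\int[Q]_s (Y i s)%:E).
  pose g (t : n.-tuple R) := (tnth t i)%:E.
  transitivity (\int[P]_w g [tuple X i w | i < n]).
    by apply: eq_integral => w _; rewrite /g tnth_mktuple.
  rewrite integral_gaussian_vector.
    by apply: eq_integral => w _; rewrite /g tnth_mktuple.
  by apply/measurable_EFinP; exact: measurable_tnth.
under eq_integral do rewrite EFinD -sumEFin.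
have iAZ j : Q.-integrable setT (fun s => (A i j * Z j s)%:E).
  under eq_fun do rewrite EFinM.
  by apply: integrableZl => //; exact: integrable_std_normal (lawZ' j).
rewrite integralD//; last 2 first.
- exact: finite_measure_integrable_cst.
- exact: integrable_sum.
rewrite integral_cst//= probability_setT mule1 integral_sum//.
rewrite big1 ?adde0// => j _.
under eq_integral do rewrite EFinM.
rewrite integralZl//; last exact: integrable_std_normal (lawZ' j).
by rewrite (integral_std_normal _ (lawZ' j))// mule0.
Qed.

Lemma mean_gaussian_vector i : mean_fun P X i = m i.
Proof. by rewrite /mean_fun unlock integral_gaussian_coord. Qed.

Lemma cov_gaussian_vector i k :
  cov_fun P X i k = (\sum_(j < n) A i j * A k j)%R.
Proof.
rewrite /cov_fun unlock -!/(mean_fun P X _) !mean_gaussian_vector unlock.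
transitivity (fine (\int[Q]_s ((Y i s - m i) * (Y k s - m k))%:E)).
  congr fine.
  pose g (t : n.-tuple R) := ((tnth t i - m i) * (tnth t k - m k))%:E.
  transitivity (\int[P]_w g [tuple X i w | i < n]).
    by apply: eq_integral => w _; rewrite /g !tnth_mktuple.
  rewrite integral_gaussian_vector.
    by apply: eq_integral => w _; rewrite /g !tnth_mktuple.
  apply/measurable_EFinP; apply: measurable_funM;
    by apply: measurable_funB => //; exact: measurable_tnth.
have iAZ j l : Q.-integrable setT (fun s => (A i j * A k l * (Z j s * Z l s))%:E).
  under eq_fun do rewrite EFinM.
  by apply: integrableZl => //; exact: integrable_std_normalM.
have YB j s : (Y j s - m j = \sum_(l < n) A j l * Z l s)%R.
  by rewrite /Y addrC addKr.
under eq_integral => s _.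
  rewrite !YB big_distrlr/= -sumEFin.
  under eq_bigr => j _.
    rewrite -sumEFin; under eq_bigr do rewrite mulrACA; over.
  over.
rewrite integral_sum => [|//|j]; last exact: integrable_sum.
transitivity (fine (\sum_(j < n) (A i j * A k j)%:E)); last by rewrite sumEFin.
congr fine; apply: eq_bigr => j _; rewrite integral_sum//.
rewrite (bigD1 j)//= big1 ?adde0 => [|l lj]; under eq_integral do rewrite EFinM.
  by rewrite integralZl ?integrable_std_normalM// integral_std_normalM eqxx mule1.
rewrite integralZl ?integrable_std_normalM// integral_std_normalM.
by rewrite eq_sym (negbTE lj) mule0.
Qed.

(** The variance is the sum of the squares of row [i] of [A], so a zero variance makes the whole row
    vanish. *)
Lemma cov_gaussian_vector_eq0 i k : cov_fun P X i i = 0%R -> cov_fun P X i k = 0%R.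
Proof.
rewrite !cov_gaussian_vector => /eqP; rewrite psumr_eq0; last first.
  by move=> j _; rewrite -expr2 sqr_ge0.
move=> /allP A0; rewrite big1// => j _.
by have := A0 j (mem_index_enum j); rewrite /= mulf_eq0 orbb => /eqP->; rewrite mul0r.
Qed.

End gaussian_vector.

(** * Gaussian densities in one and two dimensions *)

Section gaussian_density.
Local Open Scope ereal_scope.
Context (R : realType) d (T : measurableType d) (P : probability T R).
Context (I : Type) (W : I -> {RV P >-> R}).
Let w (i : I) : T -> R := W i.
Local Notation mu := (@lebesgue_measure R).
Local Notation phi := (@normal_pdf R 0 1).

Lemma normal_peak1E : @normal_peak R 1 = (Num.sqrt (2 * pi))^-1%R.
Proof. by rewrite /normal_peak expr1n mul1r mulr_natl. Qed.

Lemma measurable_gauss_density x : measurable_fun setT (gauss_density P w x).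
Proof.
apply: measurable_funM => //; do 2 apply: measurableT_comp => //.
by apply: measurable_funM => //; apply: measurable_funX; exact: measurable_funB.
Qed.

Lemma gauss_density_ge0 x u : (0 <= gauss_density P w x u)%R.
Proof. by rewrite divr_ge0 ?expR_ge0 ?sqrtr_ge0. Qed.

(** In law, [W x] is [a Z + m] with [a ^+ 2] the variance. Substituting [u = a z + m] on the density
    side produces a factor [|a|], which the square root of the variance cancels; [a] may be
    negative. *)
Lemma ge0_integral_gaussian_density (x : I) (G : R -> \bar R) :
  multivariate_gaussian P (fun _ : 'I_1 => w x) ->
  var_fun P w x != 0%R ->
  measurable_fun setT G -> (forall u, 0 <= G u) ->
  \int[P]_om G (W x om) = \int[mu]_u (G u * (gauss_density P w x u)%:E).
Proof.
move=> [dS [S [Q [Z [m [A [indZ lawZ lawX]]]]]]] v0 mG G0.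
pose X (i : 'I_1) := w x.
have mX i : measurable_fun setT (X i) by exact: measurable_funPT.
have mE : mean_fun P w x = m ord0 := mean_gaussian_vector mX lawZ lawX ord0.
have vE : var_fun P w x = (A ord0 ord0 ^+ 2)%R.
  have := cov_gaussian_vector mX indZ lawZ lawX ord0 ord0.
  by rewrite big_ord1 -expr2.
have a0 : A ord0 ord0 != 0%R by move: v0; rewrite vE expf_eq0.
set a := A ord0 ord0 in vE a0 *.
pose g (t : 1.-tuple R) := G (tnth t ord0).
transitivity (\int[P]_om g [tuple X i om | i < 1]).
  by apply: eq_integral => om _; rewrite /g tnth_mktuple.
rewrite (integral_gaussian_vector mX lawX); last first.
  by apply: measurableT_comp => //; exact: measurable_tnth.
transitivity (\int[Q]_s G (a * Z ord0 s + m ord0)%R).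
  by apply: eq_integral => s _; rewrite /g tnth_mktuple big_ord1 addrC.
have mGa : measurable_fun setT (fun z => G (a * z + m ord0)%R).
  by apply: measurableT_comp => //; exact: measurable_fun_affine.
rewrite (ge0_integral_std_normal (Z := Z ord0) _ (lawZ ord0) mGa)//.
rewrite (ge0_integral_affine (m ord0) a0
   (G := fun u => G u * (gauss_density P w x u)%:E)); last 2 first.
- apply: emeasurable_funM => //; apply/measurable_EFinP.
  exact: measurable_gauss_density.
- by move=> u; rewrite mule_ge0// lee_fin gauss_density_ge0.
have mphi : measurable_fun setT (fun z => (gauss_density P w x (a * z + m ord0))%:E).
  apply/measurable_EFinP; apply: measurableT_comp.
    exact: measurable_gauss_density.
  exact: measurable_fun_affine.
rewrite -ge0_integralZl//; last 2 first.
- exact: emeasurable_funM.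
- by move=> u _; rewrite mule_ge0// lee_fin gauss_density_ge0.
apply: eq_integral => z _; rewrite muleCA -EFinM; congr (_ * _%:E).
rewrite std_normal_pdfE normal_peak1E /gauss_density mE vE addrK.
rewrite [(2 * pi * _)%R]mulrC (sqrtrM (2 * pi) (sqr_ge0 a)) sqrtr_sqr.
have s0 : Num.sqrt (2 * pi) != 0%R :> R.
  by rewrite sqrtr_eq0 -ltNge mulr_gt0// pi_gt0.
have -> : ((a * z) ^+ 2 / (2 * a ^+ 2) = z ^+ 2 / 2)%R by field.
by field; rewrite s0 normr_eq0.
Qed.

Section two_points.
Local Open Scope ring_scope.
Variables x x' : I.
Let v := var_fun P w x.
Let v' := var_fun P w x'.
Let c := cov_fun P w x x'.
Let D := (v * v' - c ^+ 2)%R.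

Let adj : 'M[R]_(1 + 1) := block_mx v'%:M (- c)%:M (- c)%:M v%:M.

Let mul_cov_adj : cov_mx P w x x' *m adj = D%:M.
Proof.
rewrite /cov_mx /adj mulmx_block -!scalar_mxM -!raddfD/=.
rewrite [RHS]scalar_mx_block -/v -/v' -/c.
have -> : v * - c + c * v = 0 by ring.
have -> : c * v' + v' * - c = 0 by ring.
rewrite raddf0; congr (block_mx _%:M _ _ _%:M); rewrite /D; ring.
Qed.

(** If [D = 0], the product of the matrix with its adjugate is zero. Cancelling the invertible
    matrix kills the adjugate, hence all the entries, and the zero matrix is not invertible. *)
Lemma cov_mx_unit_neq0 : cov_mx P w x x' \in unitmx -> D != 0%R.
Proof.
move=> uS; apply/eqP => D0.
have adj0 : adj = 0 by rewrite -(mulKmx uS adj) mul_cov_adj D0 raddf0 mulmx0.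
have entry0 (B C E F : 'M[R]_1) : block_mx B C E F = 0 ->
    [/\ B ord0 ord0 = 0, C ord0 ord0 = 0 & F ord0 ord0 = 0]%R.
  rewrite -(block_mx0 R 1 1 1 1) => /eq_block_mx[-> -> _ ->].
  by rewrite !mxE.
have [] := entry0 _ _ _ _ adj0; rewrite !mxE eqxx !mulr1n => v'0 /eqP.
rewrite oppr_eq0 => /eqP c0 v0.
have S0 : cov_mx P w x x' = 0.
  by rewrite /cov_mx -/v -/v' -/c v0 v'0 c0 raddf0 block_mx0.
have := mulVmx uS; rewrite S0 mulmx0 => /matrixP/(_ ord0 ord0)/eqP.
by rewrite !mxE eqxx eq_sym oner_eq0.
Qed.

(** The exponent becomes a rational expression in the entries, on which measurability and the change
    of variables can be checked. *)
Lemma gauss_density2E u1 u2 : cov_mx P w x x' \in unitmx ->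
  gauss_density2 P w x x' u1 u2 =
  (expR (- ((v' * (u1 - mean_fun P w x) ^+ 2
             - 2 * c * (u1 - mean_fun P w x) * (u2 - mean_fun P w x')
             + v * (u2 - mean_fun P w x') ^+ 2) / (2 * D))) /
   (Num.sqrt ((2 * pi) ^+ 2 * D)))%R.
Proof.
move=> uS; have D0 := cov_mx_unit_neq0 uS.
have invE : invmx (cov_mx P w x x') = D^-1 *: adj.
  rewrite -[RHS](mulKmx uS) -scalemxAr mul_cov_adj scale_scalar_mx mulVf//.
  by rewrite mulmx1.
rewrite /gauss_density2 invE -scalemxAr -scalemxAl tr_col_mx !tr_scalar_mx.
rewrite /adj mul_row_block mul_row_col -!scalar_mxM -!raddfD/= -!scalar_mxM.
rewrite -raddfD !mxE eqxx !mulr1n -/D.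
by congr (expR (- _) / _); field.
Qed.

Lemma gauss_density2_ge0 u1 u2 : 0 <= gauss_density2 P w x x' u1 u2.
Proof. by rewrite divr_ge0 ?expR_ge0 ?sqrtr_ge0. Qed.

Lemma measurable_gauss_density2 : cov_mx P w x x' \in unitmx ->
  measurable_fun setT (fun p : R * R => gauss_density2 P w x x' p.1 p.2).
Proof.
move=> uS; under eq_fun do rewrite gauss_density2E//.
apply: measurable_funM => //; do 2 apply: measurableT_comp => //.
have m1 : measurable_fun setT (fun p : R * R => p.1 - mean_fun P w x).
  exact: measurable_funB.
have m2 : measurable_fun setT (fun p : R * R => p.2 - mean_fun P w x').
  exact: measurable_funB.
apply: measurable_funM => //; apply: measurable_funD.
  apply: measurable_funB; apply: measurable_funM => //; last exact: measurable_funM.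
  exact: measurable_funX.
by apply: measurable_funM => //; exact: measurable_funX.
Qed.

(** A zero variance forces a zero covariance, and then [D = 0]. *)
Lemma var_gaussian_pair_neq0 :
  multivariate_gaussian P (fun i : 'I_2 => w (if i == ord0 then x else x')) ->
  cov_mx P w x x' \in unitmx -> v != 0 /\ v' != 0.
Proof.
move=> [dS [S [Q [Z [m [A [indZ lawZ lawX]]]]]]] /cov_mx_unit_neq0 D0.
pose X (i : 'I_2) : T -> R := w (if i == ord0 then x else x').
have mX i : measurable_fun setT (X i) by exact: measurable_funPT.
pose o1 : 'I_2 := lift ord0 ord0.
have cov0 i k := @cov_gaussian_vector_eq0 _ _ _ _ _ _ mX _ _ _ _ _ _ indZ lawZ lawX i k.
split; apply: contraNneq D0 => v0; rewrite /D v0 ?(mul0r, mulr0) sub0r oppr_eq0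
    expf_eq0/=; apply/eqP.
  exact: (cov0 ord0 o1).
have := cov0 o1 ord0 v0.
by rewrite /cov_fun covarianceC.
Qed.

Local Open Scope ereal_scope.

(** The substitution [L] has Jacobian [|det A|], which is the square root of [D = det (A A^T)], and
    it turns the quadratic form of the density into [z.1 ^+ 2 + z.2 ^+ 2]. *)
Lemma ge0_integral_gaussian_density2 (G : R * R -> \bar R) :
  multivariate_gaussian P (fun i : 'I_2 => w (if i == ord0 then x else x')) ->
  cov_mx P w x x' \in unitmx ->
  measurable_fun setT G -> (forall p, 0 <= G p) ->
  \int[P]_om G (W x om, W x' om) =
  \int[mu \x mu]_p (G p * (gauss_density2 P w x x' p.1 p.2)%:E).
Proof.
move=> [dS [S [Q [Z [m [A [indZ lawZ lawX]]]]]]] uS mG G0.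
have D0 := cov_mx_unit_neq0 uS.
pose X (i : 'I_2) : T -> R := w (if i == ord0 then x else x').
have mX i : measurable_fun setT (X i) by exact: measurable_funPT.
pose o0 : 'I_2 := ord0; pose o1 : 'I_2 := lift ord0 ord0.
have m0E : mean_fun P w x = m o0 := mean_gaussian_vector mX lawZ lawX o0.
have m1E : mean_fun P w x' = m o1 := mean_gaussian_vector mX lawZ lawX o1.
have covE i k := cov_gaussian_vector mX indZ lawZ lawX i k.
have vE : v = (A o0 o0 ^+ 2 + A o0 o1 ^+ 2)%R.
  by have := covE o0 o0; rewrite big_ord_recl big_ord1 -!expr2.
have v'E : v' = (A o1 o0 ^+ 2 + A o1 o1 ^+ 2)%R.
  by have := covE o1 o1; rewrite big_ord_recl big_ord1 -!expr2.
have cE : c = (A o0 o0 * A o1 o0 + A o0 o1 * A o1 o1)%R.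
  by have := covE o0 o1; rewrite big_ord_recl big_ord1.
set a := A o0 o0 in vE cE; set b := A o0 o1 in vE cE.
set p := A o1 o0 in v'E cE; set q := A o1 o1 in v'E cE.
(* Lagrange's identity: the Gram determinant of the two rows of [A] is the square of their
   determinant. *)
have DE : D = ((a * q - b * p) ^+ 2)%R by rewrite /D vE v'E cE; ring.
have det0 : (a * q - b * p != 0)%R by move: D0; rewrite DE expf_eq0.
pose L (z : R * R) := (a * z.1 + b * z.2 + m o0, p * z.1 + q * z.2 + m o1)%R.
have mL : measurable_fun setT L by exact: measurable_fun_affine2.
pose h z := G (L z).
have mh : measurable_fun setT h by exact: measurableT_comp.
have h0 z : 0 <= h z by exact: G0.
transitivity (\int[Q]_s h (Z o0 s, Z o1 s)).
  pose g (t : 2.-tuple R) := G (tnth t o0, tnth t o1).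
  transitivity (\int[P]_om g [tuple X i om | i < 2]).
    by apply: eq_integral => om _; rewrite /g !tnth_mktuple.
  rewrite (integral_gaussian_vector mX lawX).
    apply: eq_integral => s _; rewrite /g !tnth_mktuple /h /L/=.
    by rewrite !big_ord_recl !big_ord0 !addr0 ![(m _ + _)%R]addrC.
  apply: measurableT_comp => //.
  by apply: measurable_fun_pair; exact: measurable_tnth.
have indZ01 : independent_pair Q (Z o0 : S -> R) (Z o1 : S -> R).
  exact: (mutually_independent_pair indZ).
rewrite (ge0_integral_independent _ _ indZ01 mh)//.
have mphi : measurable_fun setT (EFin \o phi).
  by apply/measurable_EFinP; exact: measurable_normal_pdf.
(* Independence has made the expectation iterated. In [k] only the inner variable has received its
   density; [kk] below carries both. *)
pose k (z : R * R) := h z * (phi z.2)%:E.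
have mk : measurable_fun setT k.
  by apply: emeasurable_funM => //; exact: (measurableT_comp mphi).
have k0 z : 0 <= k z by rewrite mule_ge0// lee_fin normal_pdf_ge0.
have mF := measurable_fun_fubini_tonelli_F (m2 := mu) k mk k0.
transitivity (\int[Q]_s fubini_F mu k (Z o0 s)).
  apply: eq_integral => s _.
  rewrite (ge0_integral_std_normal (Z := Z o1) _ (lawZ o1)
    (G := fun y => h (Z o0 s, y)))//.
  exact: measurable_fun_pair2.
rewrite (ge0_integral_std_normal (Z := Z o0) _ (lawZ o0) mF)//; last first.
  by move=> y; exact: integral_ge0.
pose kk (z : R * R) := h z * (phi z.1 * phi z.2)%:E.
have mkk : measurable_fun setT kk.
  apply: emeasurable_funM => //; apply/measurable_EFinP.
  by apply: measurable_funM; apply: measurableT_comp => //;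
    exact: measurable_normal_pdf.
have kk0 z : 0 <= kk z by rewrite mule_ge0// lee_fin mulr_ge0 ?normal_pdf_ge0.
transitivity (\int[mu \x mu]_z kk z).
  rewrite (fubini_tonelli1 (m1 := mu) (m2 := mu) _ mkk kk0).
  apply: eq_integral => y _; rewrite /fubini_F.
  have mky : measurable_fun setT (fun z => k (y, z)) by exact: measurable_fun_pair2.
  rewrite -(ge0_integralZr mu measurableT mky) ?lee_fin ?normal_pdf_ge0//.
  by apply: eq_integral => z _; rewrite /k /kk/= -muleA -EFinM [in RHS]mulrC.
have mGf : measurable_fun setT
    (fun p : R * R => G p * (gauss_density2 P w x x' p.1 p.2)%:E).
  apply: emeasurable_funM => //; apply/measurable_EFinP.
  exact: measurable_gauss_density2.
rewrite [RHS](ge0_integral_affine2 (m o0) (m o1) det0 mGf); last first.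
  by move=> z; rewrite mule_ge0// lee_fin gauss_density2_ge0.
have mGfL : measurable_fun setT (fun z : R * R => G (L z) *
    (gauss_density2 P w x x' (L z).1 (L z).2)%:E).
  exact: (measurableT_comp mGf mL).
rewrite -(ge0_integralZl (mu \x mu) measurableT mGfL)//; last first.
  by move=> z _; rewrite mule_ge0// lee_fin gauss_density2_ge0.
apply: eq_integral => z _; rewrite /kk muleCA -EFinM; congr (_ * _%:E).
rewrite gauss_density2E// m0E m1E DE /L /= !addrK vE v'E cE.
rewrite sqrtrM ?sqr_ge0// !sqrtr_sqr (@ger0_norm _ (2 * pi)) ?mulr_ge0 ?pi_ge0//.
rewrite !std_normal_pdfE normal_peak1E mulrACA -expRD -invfM -expr2.
rewrite sqr_sqrtr ?mulr_ge0 ?pi_ge0//.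
rewrite (_ : (- (z.1 ^+ 2 / 2) + _)%R = - ((z.1 ^+ 2 + z.2 ^+ 2) / 2))%R; last first.
  by rewrite -opprD mulrDl.
set e1 := (_ / 2)%R; set e2 := (_ / (2 * _))%R.
(* In the coordinates [z] the numerator of [e2] is [D (z.1 ^+ 2 + z.2 ^+ 2)]. *)
have -> : e2 = e1 by rewrite /e1 /e2; field.
have pi0 : (pi : R) != 0%R by rewrite gt_eqF ?pi_gt0.
by move: (pi : R) pi0 => t t0; field; rewrite t0 normr_eq0 det0.
Qed.

End two_points.

End gaussian_density.

(** * Joint measurability of cadlag processes *)

(** Since [f] is nonnegative, the positive and negative parts of [g f] are those of [g] times [f].
    The formula thus passes from nonnegative to all measurable integrands. *)
Lemma integral_density d1 d2 (T1 : measurableType d1) (T2 : measurableType d2)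
    (R : realType) (P : {measure set T1 -> \bar R})
    (mu : {measure set T2 -> \bar R}) (X : T1 -> T2) (f : T2 -> R) :
  (forall y, 0 <= f y) ->
  (forall G : T2 -> \bar R, measurable_fun setT G -> (forall y, 0 <= G y)%E ->
    \int[P]_x G (X x) = \int[mu]_y (G y * (f y)%:E))%E ->
  forall g : T2 -> \bar R, measurable_fun setT g ->
  (\int[P]_x g (X x) = \int[mu]_y (g y * (f y)%:E))%E.
Proof.
move=> f0 Pf g mg; rewrite [LHS]integralE [RHS]integralE; congr (_ - _)%E.
  rewrite (_ : (fun x => g (X x))^\+%E = (fun x => g^\+%E (X x))); last first.
    by apply/funext => x; rewrite !funeposE.
  rewrite Pf//; last exact: measurable_funepos.
  apply: eq_integral => y _; rewrite !funeposE.
  rewrite muleC (muleC (g y)).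
  have := congr1 (fun h => h y) (ge0_funeposM g (f0 y)).
  by rewrite /= !funeposE => ->.
rewrite (_ : (fun x => g (X x))^\-%E = (fun x => g^\-%E (X x))); last first.
  by apply/funext => x; rewrite !funenegE.
rewrite Pf//; last exact: measurable_funeneg.
apply: eq_integral => y _; rewrite !funenegE.
rewrite muleC (muleC (g y)).
have := congr1 (fun h => h y) (ge0_funenegM g (f0 y)).
by rewrite /= !funenegE => ->.
Qed.

(* [l] is the pointwise limit of its values on the grids [k / n] approached
   from the right; [Num.max] discards the negative times. *)
Lemma measurable_cadlag (R : realType) d (T : measurableType d)
    (l : R -> T -> R) :
  (forall t, 0 <= t -> measurable_fun setT (l t)) ->
  (forall w, cadlag (fun t => l t w)) ->
  measurable_fun setT (fun p : R * T => l (Num.max p.1 0) p.2).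
Proof.
move=> ml cl.
(* The successor puts [s n t] strictly to the right of [t], as the punctured filter [t^'+] requires,
   and at distance at most [1 / (n + 1)]. *)
pose s n (t : R) := (Num.truncn (n.+1%:R * t)).+1%:R / n.+1%:R : R.
apply: (measurable_fun_cvg (h := fun n (p : R * T) =>
  l (s n (Num.max p.1 0)) p.2)) => [n|[t w] _ /=].
  (* On each of these countably many strips the time is constant, so only the measurability of one
     [l t] is involved. *)
  pose E k := [set p : R * T | k%:R <= n.+1%:R * Num.max p.1 0 < k.+1%:R].
  have mE k : measurable (E k).
    have mf : measurable_fun setT (fun p : R * T => n.+1%:R * Num.max p.1 0).
      by apply: measurable_funM => //; exact: measurable_maxr.
    have := mf measurableT `[k%:R, k.+1%:R[%classic; rewrite setTI.
    rewrite (_ : _ @^-1` _ = E k); first by apply.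
    by apply/seteqP; split => p /=; rewrite in_itv.
  have <- : \bigcup_k E k = setT.
    apply/seteqP; split => // p _; exists (Num.truncn (n.+1%:R * Num.max p.1 0)) => //.
    by apply: truncn_itv; rewrite mulr_ge0// le_max lexx orbT.
  apply/measurable_fun_bigcup => // k.
  apply: (@eq_measurable_fun _ _ _ _ _ (fun p => l (k.+1%:R / n.+1%:R) p.2)).
    move=> p /set_mem Ekp; rewrite /s.
    by rewrite (truncn_def Ekp).
  apply: measurable_funTS; apply: measurableT_comp => //.
  by apply: ml; rewrite divr_ge0.
set t0 := Num.max t 0.
have t0_ge0 : 0 <= t0 by rewrite le_max lexx orbT.
have [/cvg_at_rightP cvgl _] := cl w t0 t0_ge0.
have trunc_s n : t0 < s n t0 <= t0 + n.+1%:R^-1.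
  have /andP[h1 h2] := truncn_itv (mulr_ge0 (ler0n R n.+1) t0_ge0).
  rewrite /s ltr_pdivlMr// mulrC h2/= ler_pdivrMr// mulrDl mulVf//.
  by rewrite -[leLHS]natr1 lerD2r (mulrC t0).
apply: cvgl; split => [n|]; first by have /andP[] := trunc_s n.
apply: (@squeeze_cvgr _ _ _ _ (cst t0) (fun n => t0 + n.+1%:R^-1)).
- by near=> n; have /andP[/ltW -> ->] := trunc_s n.
- exact: cvg_cst.
- rewrite -[X in _ --> X]addr0; apply: cvgD; first exact: cvg_cst.
  exact: cvg_harmonic.
Unshelve. all: by end_near. Qed.

(** * Moments of Levy processes *)

Section levy_moments.
Local Open Scope ereal_scope.
Context (R : realType) d (T : measurableType d) (P : probability T R).
Variables (l : R -> {RV P >-> R}).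
Hypotheses (l_levy : levy_process P l) (l_moments : has_two_moments P l).
Let l' (t : R) : T -> R := l t.

Lemma mean_levyE t : (0 <= t)%R -> (mean_fun P l' t)%:E = \int[P]_w (l t w)%:E.
Proof.
move=> t0; rewrite /mean_fun unlock fineK//.
exact: integrable_fin_num (l_moments t0).1.
Qed.

Lemma second_moment_levyE t : (0 <= t)%R ->
  (second_moment_fun P l' t)%:E = \int[P]_w (l t w ^+ 2)%:E.
Proof.
move=> t0; rewrite /second_moment_fun unlock fineK//.
exact: integrable_fin_num (l_moments t0).2.
Qed.

Let integral_levy0M (f : T -> R) : measurable_fun setT f ->
  \int[P]_w (l 0%R w * f w)%:E = 0.
Proof.
move=> mf; rewrite -(integral0 P setT); apply: ae_eq_integral => //.
  by apply/measurable_EFinP; exact: measurable_funM.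
by apply: filterS (levy0 l_levy) => w /= l0 _; rewrite l0 mul0r.
Qed.

Lemma mean_levy0 : mean_fun P l' 0%R = 0%R.
Proof.
apply: EFin_inj; rewrite mean_levyE//.
have := integral_levy0M (f := cst 1%R) (measurable_cst _).
by under eq_integral do rewrite mulr1.
Qed.

Lemma integral_levy_increment s h : (0 <= s)%R -> (0 <= h)%R ->
  \int[P]_w (l (s + h) w - l s w)%:E = (mean_fun P l' h)%:E.
Proof.
move=> s0 h0.
have minc t u : measurable_fun setT (fun w => l t w - l u w)%R.
  exact: measurable_funB.
have mE : measurable_fun setT (@EFin R) by exact: EFin_measurable.
transitivity (\int[P]_w (l h w - l 0%R w)%:E).
  rewrite -(integral_pushforward_measurable (minc (s + h)%R s) _ mE).
  rewrite -(integral_pushforward_measurable (minc h 0%R) _ mE).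
  apply: eq_measure_integral => B mB _.
  exact: (levy_stationary_increments l_levy).
under eq_integral do rewrite EFinB.
rewrite integralB//; [|exact: (l_moments _).1..].
by rewrite -!mean_levyE// mean_levy0 sube0.
Qed.

(** Almost surely [l s * l t = (l s - l 0) * (l t - l s) + l s ^+ 2], and the two increments are
    independent. *)
Let integral_levyM_le s t : (0 <= s)%R -> (s <= t)%R ->
  \int[P]_w (l s w * l t w)%:E =
  (mean_fun P l' s * mean_fun P l' (t - s) + second_moment_fun P l' s)%:E.
Proof.
(* The cases [s = t] and [s = 0] are set apart because independence of increments is stated for
   strictly increasing times. *)
move=> s0; rewrite le_eqVlt => /predU1P[<-|st].
  by rewrite subrr mean_levy0 mulr0 add0r second_moment_levyE.
have [->|s_neq0] := eqVneq s 0%R.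
  rewrite integral_levy0M// mean_levy0 mul0r add0r second_moment_levyE//.
  by under eq_integral do rewrite expr2; rewrite integral_levy0M.
have s_gt0 : (0 < s)%R by rewrite lt_def s_neq0.
pose X w := (l s w - l 0%R w)%R; pose Y w := (l t w - l s w)%R.
(* The times [0, s, t] are continued by [t + 1, t + 2, ...], since an infinite increasing sequence
   is required; the tail is irrelevant. *)
pose u (n : nat) := if n is n'.+1 then (if n' is n''.+1 then t + n''%:R else s)%R else 0%R.
have u_incr : {homo u : i j / (i < j)%N >-> (i < j)%R}.
  apply: homo_ltn => [x y z|[|[|i]]] //=; first exact: lt_trans.
    by rewrite addr0.
  by rewrite ltrD2l ltr_nat.
have t0 : (0 <= t)%R by apply: le_trans (ltW st).
have indXY : independent_pair P X Y.
  have ind := levy_independent_increments l_levy (n := 2) (t := u) (lexx _) u_incr.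
  have ij : ord0 != lift ord0 ord0 :> 'I_2 by [].
  by have := mutually_independent_pair ind ij; rewrite /u/= addr0.
have iX : P.-integrable setT (EFin \o X).
  rewrite (_ : EFin \o X = (EFin \o l s) \- (EFin \o l 0%R))//.
  by apply: integrableB => //; exact: (l_moments _).1.
have iY : P.-integrable setT (EFin \o Y).
  rewrite (_ : EFin \o Y = (EFin \o l t) \- (EFin \o l s))//.
  by apply: integrableB => //; exact: (l_moments _).1.
transitivity (\int[P]_w ((X w * Y w)%:E + (l s w ^+ 2)%:E)).
  apply: ae_eq_integral => //.
  - by apply/measurable_EFinP; exact: measurable_funM.
  - apply: emeasurable_funD; apply/measurable_EFinP.
      by apply: measurable_funM; exact: measurable_funB.
    exact: measurable_funX.
  - apply: filterS (levy0 l_levy) => w /= l0 _.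
    by rewrite -EFinD /X /Y l0; congr EFin; ring.
rewrite integralD//; [|exact: integrable_independentM|exact: (l_moments _).2].
rewrite integral_independentM// EFinD second_moment_levyE//; congr (_ + _).
rewrite EFinM; congr (_ * _).
  have := integral_levy_increment (lexx 0%R) s0.
  by under eq_integral do rewrite add0r.
have := integral_levy_increment (h := (t - s)%R) s0.
under eq_integral do rewrite (addrC s) subrK.
by apply; rewrite subr_ge0 ltW.
Qed.

Lemma integral_levyM s t : (0 <= s)%R -> (0 <= t)%R ->
  \int[P]_w (l s w * l t w)%:E = (levy_c P l' s t)%:E.
Proof.
move=> s0 t0; rewrite /levy_c.
wlog st : s t s0 t0 / (s <= t)%R.
  move=> H; have [st|ts] := orP (le_total s t); first exact: H.
  rewrite distrC minC -H//.
  by apply: eq_integral => w _; rewrite mulrC.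
rewrite distrC ger0_norm ?subr_ge0// (min_idPl st) integral_levyM_le//.
by rewrite [X in (X + _)%R]mulrC.
Qed.

End levy_moments.

(** * Subordinated fields *)

Section generated_sigma_algebra.
Context (R : realType) d (T : measurableType d).

(** These generate [sigma_generated]. Passed to [g_sigma_algebraType], they give a copy of [T] whose
    measurable sets are exactly the events of the process. *)
Definition generators I (J : set I) (X : I -> T -> R) : set (set T) :=
  \bigcup_(i in J) preimage_set_system setT (X i) measurable.

Lemma measurable_fun_generators I (J : set I) (X : I -> T -> R) i : J i ->
  measurable_fun setT (X i : g_sigma_algebraType (generators J X) -> R).
Proof. by move=> Ji _ B mB; apply: sub_sigma_algebra; exists i => //; exists B. Qed.

Lemma measurable_id_generators I (J : set I) (X : I -> T -> R) :
  (forall i, J i -> measurable_fun setT (X i)) ->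
  measurable_fun setT (idfun : T -> g_sigma_algebraType (generators J X)).
Proof.
move=> mX _ B mB; rewrite setTI; apply: smallest_sub mB => /=.
  exact: sigma_algebra_measurable.
by move=> _ [i Ji [C mC <-]]; exact: mX.
Qed.

(** The identity into the coarse copy carries all the information of [X], so independence of
    processes becomes independence of two maps, with [V] any functional of [Y]. *)
Lemma independent_processes_pair (P : probability T R) I I' (J : set I)
    (X : I -> T -> R) (J' : set I') (Y : I' -> T -> R)
    d1 (T1 : measurableType d1) (V : T -> T1) :
  independent_processes P J X J' Y ->
  measurable_fun setT (V : g_sigma_algebraType (generators J' Y) -> T1) ->
  independent_pair P V (idfun : T -> g_sigma_algebraType (generators J X)).
Proof.
move=> ind mV A B mA mB; rewrite setIC muleC; apply: ind => //.
by have := mV measurableT A mA; rewrite setTI.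
Qed.

End generated_sigma_algebra.

Section subordinated.
Local Open Scope ereal_scope.
Context (R : realType) dT (T : measurableType dT) (P : probability T R).
Context d (D : set 'rV[R]_d) (W : 'rV[R]_d -> {RV P >-> R}).
Hypothesis W_gaussian : gaussian_random_field P D W.
Variable l : R -> {RV P >-> R}.
Hypotheses (l_levy : levy_process P l) (l_moments : has_two_moments P l).
Hypothesis lW_independent :
  independent_processes P [set t : R | (0 <= t)%R] (fun t => l t : T -> R)
                          D (fun x => W x : T -> R).
Variables (F : R -> R).
Hypotheses (mF : measurable_fun setT F) (F_ge0 : forall u, (0 <= F u)%R).

Let w x := W x : T -> R.
Let l' t := l t : T -> R.
Let L := subordinated_field l' F w.
Let T' := g_sigma_algebraType (generators [set t : R | (0 <= t)%R] l').
Let TW := g_sigma_algebraType (generators D w).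
Local Notation mu := (@lebesgue_measure R).

Let mid : measurable_fun setT (idfun : T -> T').
Proof. by apply: measurable_id_generators => t _; exact: measurable_funPT. Qed.

Let mw x : measurable_fun setT (w x).
Proof. exact: measurable_funPT. Qed.

(** The second factor is [T'], whose events are those of [l] only. The truncation of times at [0] is
    invisible because [F] is nonnegative. *)
Let measurable_subordinator :
  measurable_fun setT (fun p : R * T' => l' (F p.1) p.2).
Proof.
have mcad : measurable_fun setT (fun p : R * T' => l' (Num.max p.1 0%R) p.2).
  apply: measurable_cadlag => [t t0|]; first exact: measurable_fun_generators.
  exact: (levy_cadlag l_levy).
have mFid : measurable_fun setT (fun p : R * T' => (F p.1, p.2)).
  by apply: measurable_fun_pair => //; exact: measurableT_comp.
apply: eq_measurable_fun (measurableT_comp mcad mFid) => p _ /=.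
by rewrite (max_idPl (F_ge0 _)).
Qed.

Let indep1 x : D x -> independent_pair P (w x) (idfun : T -> T').
Proof.
move=> Dx; apply: independent_processes_pair lW_independent _.
exact: measurable_fun_generators.
Qed.

Let indep2 x x' : D x -> D x' ->
  independent_pair P (fun om => (w x om, w x' om)) (idfun : T -> T').
Proof.
move=> Dx Dx'; apply: independent_processes_pair lW_independent _.
by apply: (@measurable_fun_pair _ _ _ TW); exact: measurable_fun_generators.
Qed.

Let integral_law1 x (g : R -> \bar R) : D x -> var_fun P w x != 0%R ->
  measurable_fun setT g ->
  \int[P]_om g (w x om) = \int[mu]_u (g u * (gauss_density P w x u)%:E).
Proof.
move=> Dx v0 mg.
apply: (@integral_density _ _ T (measurableTypeR R)) => //.
- exact: gauss_density_ge0.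
- move=> G mG G0; apply: ge0_integral_gaussian_density => //.
  exact: (W_gaussian.2 1%N (fun=> x)).
Qed.

Lemma integral_subordinated x : D x -> var_fun P w x != 0%R ->
  P.-integrable setT (EFin \o L x) ->
  \int[P]_om (L x om)%:E =
  \int[mu]_u (mean_fun P l' (F u) * gauss_density P w x u)%:E.
Proof.
move=> Dx v0 iL; pose h (p : R * T') := (l' (F p.1) p.2)%:E.
have mh : measurable_fun setT h by exact/measurable_EFinP.
have hE u : \int[P]_om h (u, om) = (mean_fun P l' (F u))%:E.
  by rewrite mean_levyE.
rewrite (integral_independent (mw x) mid (indep1 Dx) mh)//.
under eq_integral do rewrite hE.
rewrite (integral_law1 (g := fun u => (mean_fun P l' (F u))%:E))//.
(* The mean of [l] at time [F u] is measurable in [u] as a section integral of [h]. *)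
apply: (eq_measurable_fun (fun p => \int[P]_om h (p, om))) => [p _|].
  by rewrite hE.
exact: (measurable_fun_integral_section P mid mh).
Qed.

(** A square is nonnegative, so Tonelli applies and both sides may be infinite. *)
Lemma integral_sqr_subordinated x : D x -> var_fun P w x != 0%R ->
  \int[P]_om (L x om ^+ 2)%:E =
  \int[mu]_u (second_moment_fun P l' (F u) * gauss_density P w x u)%:E.
Proof.
move=> Dx v0; pose h (p : R * T') := (l' (F p.1) p.2 ^+ 2)%:E.
have mh : measurable_fun setT h by apply/measurable_EFinP; exact: measurable_funX.
have hE u : \int[P]_om h (u, om) = (second_moment_fun P l' (F u))%:E.
  by rewrite second_moment_levyE.
rewrite (ge0_integral_independent (mw x) mid (indep1 Dx) mh)//; last first.
  by move=> p; rewrite lee_fin sqr_ge0.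
under eq_integral do rewrite hE.
rewrite (integral_law1 (g := fun u => (second_moment_fun P l' (F u))%:E))//.
apply: (eq_measurable_fun (fun p => \int[P]_om h (p, om))) => [p _|].
  by rewrite hE.
exact: (measurable_fun_integral_section P mid mh).
Qed.

Lemma integral_subordinatedM x x' : D x -> D x' ->
  cov_mx P w x x' \in unitmx ->
  P.-integrable setT (fun om => (L x om * L x' om)%:E) ->
  \int[P]_om (L x om * L x' om)%:E =
  \int[mu \x mu]_p
    (levy_c P l' (F p.1) (F p.2) * gauss_density2 P w x x' p.1 p.2)%:E.
Proof.
move=> Dx Dx' uS iL.
pose h (p : (R * R) * T') := (l' (F p.1.1) p.2 * l' (F p.1.2) p.2)%:E.
have mh : measurable_fun setT h.
  have m1 : measurable_fun setT (fun p : (R * R) * T' => (p.1.1, p.2)).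
    by apply: measurable_fun_pair => //; exact: measurableT_comp.
  have m2 : measurable_fun setT (fun p : (R * R) * T' => (p.1.2, p.2)).
    by apply: measurable_fun_pair => //; exact: measurableT_comp.
  apply/measurable_EFinP; apply: measurable_funM.
    exact: (measurableT_comp measurable_subordinator m1).
  exact: (measurableT_comp measurable_subordinator m2).
have hE p : \int[P]_om h (p, om) = (levy_c P l' (F p.1) (F p.2))%:E.
  by rewrite -integral_levyM.
have mww : measurable_fun setT (fun om => (w x om, w x' om)).
  exact: measurable_fun_pair.
rewrite (integral_independent mww mid (indep2 Dx Dx') mh)//.
under eq_integral do rewrite hE.
have mc : measurable_fun setT (fun p : R * R => (levy_c P l' (F p.1) (F p.2))%:E).
  apply: (eq_measurable_fun (fun p => \int[P]_om h (p, om))) => [p _|].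
  by rewrite hE.
  exact: (measurable_fun_integral_section P mid mh).
apply: (@integral_density _ _ T
  (measurableTypeR R * measurableTypeR R)%type _ P (mu \x mu)
  (fun om => (w x om, w x' om))
  (fun p => gauss_density2 P w x x' p.1 p.2) _ _ _ mc) => [p|G mG G0].
  exact: gauss_density2_ge0.
apply: ge0_integral_gaussian_density2 => //.
have := W_gaussian.2 2%N (fun i => if i == ord0 then x else x').
by apply => i; case: ifP.
Qed.

End subordinated.

(** * Covariance and variance as differences of integrals *)

Section covariance.
Local Open Scope ereal_scope.
Context (R : realType) d (T : measurableType d) (P : probability T R).

Lemma ge0_not_integrable (f : T -> R) : measurable_fun setT f ->
  (forall x, (0 <= f x)%R) -> ~ P.-integrable setT (EFin \o f) ->
  \int[P]_x (f x)%:E = +oo.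
Proof.
move=> mf f0 nif; apply/eqP; rewrite -leye_eq leNgt; apply/negP => foo.
apply: nif; apply/integrableP; split; first exact/measurable_EFinP.
by under eq_integral do rewrite /= ger0_norm//.
Qed.

Lemma covariance_integralE (X Y : T -> R) :
  P.-integrable setT (EFin \o X) -> P.-integrable setT (EFin \o Y) ->
  P.-integrable setT (fun w => (X w * Y w)%:E) ->
  covariance P X Y =
  \int[P]_w (X w * Y w)%:E - \int[P]_w (X w)%:E * \int[P]_w (Y w)%:E.
Proof.
move=> iX iY iXY; rewrite covarianceE; first by rewrite unlock.
all: exact/Lfun1_integrable.
Qed.

(* Both sides are [+oo] when [X ^+ 2] is not integrable. *)
Lemma variance_integralE (X : T -> R) : P.-integrable setT (EFin \o X) ->
  covariance P X X =
  \int[P]_w (X w ^+ 2)%:E - (\int[P]_w (X w)%:E) ^+ 2.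
Proof.
move=> iX; have mX : measurable_fun setT X.
  by apply/measurable_EFinP; exact: measurable_int iX.
have [iX2|niX2] := pselect (P.-integrable setT (fun w => (X w * X w)%:E)).
  by rewrite covariance_integralE.
have mX2 : measurable_fun setT (fun w => X w ^+ 2)%R by exact: measurable_funX.
rewrite (ge0_not_integrable mX2); last 2 first.
- by move=> w; exact: sqr_ge0.
- exact: niX2.
have EX := integrable_fin_num measurableT iX.
rewrite -(fineK EX) -EFin_expe addye//.
rewrite unlock unlock; set m := fine _.
have mXm : measurable_fun setT (fun w => (X w - m) ^+ 2)%R.
  by apply: measurable_funX; exact: measurable_funB.
apply: (ge0_not_integrable mXm) => [w|iXm]; first exact: sqr_ge0.
apply: niX2.
(* This dominates [X w ^+ 2], the difference being [(X w - 2 * m) ^+ 2]. A finite variance would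
   therefore make the second moment finite. *)
have i2 : P.-integrable setT (fun w => (2 * (X w - m) ^+ 2 + 2 * m ^+ 2)%:E).
  under eq_fun do rewrite EFinD EFinM.
  apply: integrableD => //; first exact: integrableZl.
  exact: finite_measure_integrable_cst.
apply: le_integrable i2 => //; first exact/measurable_EFinP.
move=> w _; rewrite lee_fin -expr2 !ger0_norm ?sqr_ge0//.
  by have := sqr_ge0 (X w - 2 * m)%R; nra.
by rewrite addr_ge0// mulr_ge0// sqr_ge0.
Qed.

End covariance.

Unset Implicit Arguments.

Theorem lemma6p1 (R : realType) (dT : measure_display) (T : measurableType dT)
    (P : probability T R) (P_complete : measure_is_complete P)
    (d : nat) (D : set 'rV[R]_d)
    (W : 'rV[R]_d -> {RV P >-> R}) (W_gaussian : gaussian_random_field P D W)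
    (l : R -> {RV P >-> R}) (l_levy : levy_process P l)
    (l_moments : has_two_moments P l)
    (lW_independent :
       independent_processes P [set t : R | 0 <= t] (fun t => l t : T -> R)
                               D (fun x => W x : T -> R))
    (F : R -> R) (F_measurable : measurable_fun setT F)
    (F_ge0 : forall u, 0 <= F u) :
  let w := fun x => W x : T -> R in
  let mu_l := mean_fun P (fun t => l t : T -> R) in
  let mu2_l := second_moment_fun P (fun t => l t : T -> R) in
  let c_l := levy_c P (fun t => l t : T -> R) in
  let f1 := gauss_density P w in
  let f2 := gauss_density2 P w in
  let L := subordinated_field (fun t => l t : T -> R) F w in
  (forall x x', D x -> D x' -> x != x' ->
    cov_mx P w x x' \in unitmx ->
    P.-integrable setT (EFin \o L x) ->
    P.-integrable setT (EFin \o L x') ->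
    P.-integrable setT (EFin \o (fun om => L x om * L x' om)) ->
    covariance P (L x) (L x') =
      (\int[lebesgue_measure \x lebesgue_measure]_p
          (c_l (F p.1) (F p.2) * f2 x x' p.1 p.2)%:E
       - (\int[lebesgue_measure]_u (mu_l (F u) * f1 x u)%:E)
         * (\int[lebesgue_measure]_v (mu_l (F v) * f1 x' v)%:E))%E)
  /\
  (forall x, D x ->
    var_fun P w x != 0 ->
    P.-integrable setT (EFin \o L x) ->
    'V_P[L x]%E = covariance P (L x) (L x) /\
    covariance P (L x) (L x) =
      (\int[lebesgue_measure]_u (mu2_l (F u) * f1 x u)%:E
       - (\int[lebesgue_measure]_u (mu_l (F u) * f1 x u)%:E) ^+ 2)%E).
Proof.
move=> w mu_l mu2_l c_l f1 f2 L; split.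
  move=> x x' Dx Dx' _ uS iL iL' iLL'.
  (* The product of the means uses the one-point densities, which need nonzero variances;
     invertibility of the covariance matrix provides them. *)
  have [vx vx'] : var_fun P w x != 0 /\ var_fun P w x' != 0.
    apply: (var_gaussian_pair_neq0 _ uS).
    have := W_gaussian.2 2%N (fun i => if i == ord0 then x else x').
    by apply => i; case: ifP.
  rewrite covariance_integralE//.
  rewrite (integral_subordinatedM W_gaussian l_levy l_moments lW_independent)//.
  by rewrite !(integral_subordinated W_gaussian l_levy l_moments lW_independent).
move=> x Dx v0 iL; split=> //.
rewrite (variance_integralE iL).
rewrite (integral_sqr_subordinated W_gaussian l_levy l_moments lW_independent)//.
by rewrite (integral_subordinated W_gaussian l_levy l_moments lW_independent).
Qed.
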